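(* Let $t\in\mathbb R\setminus\{0\}$ and let $\alpha\in\mathbb H_t$ be such that $B_\alpha$ is defined (i.e. $\|\alpha\|_{op}<1$, $\Gamma_\alpha$ is invertible, and $L_\alpha$ has a $[*]$-self-adjoint square root $K_\alpha\in\mathbb H_t$). The operator $f\mapsto B_\alpha\star f$ of $\star$-multiplication by $B_\alpha$ on the left is isometric from the Krein space $\mathbf H_{2,[*]}^t$ into itself.
   Context: For $t\in\mathbb R\setminus\{0\}$, $\mathbb H_t$ is the real algebra (matrix addition and multiplication) of matrices $q_t=\begin{pmatrix}a&tb\\ \overline b&\overline a\end{pmatrix}$, $a,b\in\mathbb C$, with unit $1=I_2$; $q_t^{[*]}=\begin{pmatrix}a&t\overline b\\ b&\overline a\end{pmatrix}$, $\alpha^{[*]n}=(\alpha^{[*]})^n$; $\|q_t\|_E=\sqrt{|a|^2+|t||b|^2}$ and $\|q_t\|_{op}$ is the operator norm of the matrix on $\mathbb C^2$. $\mathbf H_2^t$ is the real vector space of power series $f(q_t)=\sum_{n=0}^\infty q_t^n\alpha_n$, $\alpha_n\in\mathbb H_t$, with $\sum_n\|\alpha_n\|_E^2<\infty$; $\mathbf H_{2,[*]}^t$ is $\mathbf H_2^t$ endowed with the real symmetric form $[f,g]_{[*]}=\sum_{n=0}^\infty{\rm Tr}\,(g_n^{[*]}f_n)$ for $f=\sum q_t^nf_n$, $g=\sum q_t^ng_n$, which makes it a real Krein space; isometric means preserving this form. The $\star$-product of power series is $\left(\sum q_t^n\alpha_n\right)\star\left(\sum q_t^n\beta_n\right)=\sum_n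 q_t^n\sum_{k=0}^n\alpha_{n-k}\beta_k$, and $S^{-\star}$ is the inverse of $S$ for $\star$. For $\alpha\in\mathbb H_t$ with $\|\alpha\|_{op}<1$ let $\Gamma_\alpha=\sum_{n=0}^\infty\alpha^n\alpha^{[*]n}$; when $\Gamma_\alpha$ is invertible let $L_\alpha=\Gamma_\alpha-\Gamma_\alpha\alpha^{[*]}\Gamma_\alpha^{-1}\alpha\Gamma_\alpha$, and let $K_\alpha=L_\alpha^{1/2}\in\mathbb H_t$ denote an element with $K_\alpha=K_\alpha^{[*]}$ and $K_\alpha^2=L_\alpha$ (these conditions hold for all $\alpha$ of small enough norm). Then $$B_\alpha(q_t)=(q_t-\alpha)\star(1-q_t\Gamma_\alpha\alpha^{[*]}\Gamma_\alpha^{-1})^{-\star}K_\alpha .$$ *)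

(* Defs.v *)
From HB Require Import structures.
From mathcomp Require Import all_boot all_order all_algebra complex ring lra.
From mathcomp Require Import all_classical all_reals all_analysis.
Set Implicit Arguments.
Unset Strict Implicit.
Unset Printing Implicit Defensive.
Import Order.TTheory GRing.Theory Num.Theory numFieldNormedType.Exports.
Local Open Scope classical_set_scope.
Local Open Scope ring_scope.
Local Open Scope complex_scope.

(* The modulus topology on R[i]; it induces the topology of 'M[R[i]]_2 in which
   the limit defining [Gamma] is taken. *)
HB.instance Definition _ (R : realType) := NormedModule.copy R[i] R[i]^o.

Definition hmat (R : realType) (t : R) (a b : R[i]) : 'M[R[i]]_2 :=
  \matrix_(i < 2, j < 2)
    if i == 0 then (if j == 0 then a else t%:C * b)
    else (if j == 0 then b^* else a^*).

Definition Ht (R : realType) (t : R) : set 'M[R[i]]_2 :=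
  [set q | exists a b : R[i], q = hmat t a b].

(* For q = hmat t a b, the entries q 0 0 and q 1 0 are a and b^*; the next two
   definitions are meaningful on [Ht t] only (see [star_hmat], [normE_hmat]). *)
Definition star (R : realType) (t : R) (q : 'M[R[i]]_2) : 'M[R[i]]_2 :=
  hmat t (q 0 0) (q 1 0).

Definition normE (R : realType) (t : R) (q : 'M[R[i]]_2) : R :=
  Num.sqrt (Normc.normc (q 0 0) ^+ 2 + `|t| * Normc.normc (q 1 0) ^+ 2).

Lemma star_hmat (R : realType) (t : R) (a b : R[i]) :
  star t (hmat t a b) = hmat t a b^*.
Proof. by rewrite /star !mxE. Qed.

Lemma normE_hmat (R : realType) (t : R) (a b : R[i]) :
  normE t (hmat t a b) =
  Num.sqrt (Normc.normc a ^+ 2 + `|t| * Normc.normc b ^+ 2).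
Proof. by rewrite /normE !mxE /=; case: b => x y /=; rewrite sqrrN. Qed.

Definition norm2 (R : realType) (v : 'cV[R[i]]_2) : R :=
  Num.sqrt (\sum_(i < 2) Normc.normc (v i 0) ^+ 2).

Definition opnorm (R : realType) (q : 'M[R[i]]_2) : R :=
  sup [set norm2 (q *m v) | v in [set v : 'cV[R[i]]_2 | norm2 v <= 1]].

(* A power series \sum_n q^n f_n is represented by its coefficients n |-> f_n. *)
Definition hseries (R : realType) : Type := nat -> 'M[R[i]]_2.

Definition smul (R : realType) (f g : hseries R) : hseries R :=
  fun n => \sum_(k < n.+1) f (n - k)%N * g k.

(* c0 + q c1 *)
Definition affine_ps (R : realType) (c0 c1 : 'M[R[i]]_2) : hseries R :=
  fun n => if n is 0%N then c0 else if n is 1%N then c1 else 0.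

Definition is_sinv (R : realType) (S T : hseries R) : Prop :=
  smul S T = affine_ps 1 0 /\ smul T S = affine_ps 1 0.

(* The default value is used only when S has no inverse. *)
Definition sinv (R : realType) (S : hseries R) : hseries R :=
  xget (affine_ps 0 0 : nat -> 'M[R[i]]_2) [set T | is_sinv S T].

Definition H2 (R : realType) (t : R) : set (hseries R) :=
  [set f | (forall n, Ht t (f n)) /\ cvgn (series (fun n => normE t (f n) ^+ 2))].

(* The trace of an element of [Ht t] is real (see [mxtrace_hmat]), so taking
   its real part only changes its type. *)
Definition kform (R : realType) (t : R) (f g : hseries R) : R :=
  limn (series (fun n => complex.Re (\tr (star t (g n) * f n)))).

Lemma hmatM (R : realType) (t : R) (a b c d : R[i]) :
  hmat t a b * hmat t c d =
  hmat t (a * c + t%:C * b * d^*) (a * d + b * c^*).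
Proof.
apply/matrixP => i j; rewrite !mxE !big_ord_recl big_ord0 !mxE /= addr0.
case: i => [[|[|i]] Hi] //; case: j => [[|[|j]] Hj] //=;
  case: a b c d => [? ?] [? ?] [? ?] [? ?]; apply/eqP;
  rewrite eq_complex /=; apply/andP; split; apply/eqP; ring.
Qed.

Lemma mxtrace_hmat (R : realType) (t : R) (a b : R[i]) :
  \tr (hmat t a b) = (complex.Re a *+ 2)%:C.
Proof.
rewrite /mxtrace !big_ord_recl big_ord0 !mxE /= addr0.
by case: a => x y; apply/eqP; rewrite eq_complex /= mulr2n subrr !eqxx.
Qed.

Lemma kform_cvg (R : realType) (t : R) (f g : hseries R) :
  H2 t f -> H2 t g ->
  cvgn (series (fun n => complex.Re (\tr (star t (g n) * f n)))).
Proof.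
move=> [fH fc] [gH gc]; apply: normed_cvg.
apply: (@series_le_cvg _ _
  (fun n => normE t (f n) ^+ 2 + normE t (g n) ^+ 2)) => //.
- by move=> n /=; exact: normr_ge0.
- by move=> n /=; rewrite addr_ge0 ?sqr_ge0.
- move=> n /=; have [[a1 a2] [[b1 b2] ->]] := fH n.
  have [[c1 c2] [[d1 d2] ->]] := gH n.
  rewrite star_hmat hmatM mxtrace_hmat !normE_hmat.
  have p0 (x y : R[i]) : 0 <= Normc.normc x ^+ 2 + `|t| * Normc.normc y ^+ 2.
    by apply: addr_ge0; [exact: sqr_ge0 | apply: mulr_ge0; [exact: normr_ge0 | exact: sqr_ge0]].
  rewrite !(sqr_sqrtr (p0 _ _)) /=.
  rewrite !sqr_sqrtr ?addr_ge0 ?sqr_ge0 //.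
  have T : `|t| ^+ 2 = t ^+ 2 by rewrite real_normK ?num_real.
  rewrite ler_norml; apply/andP; split; case: (ger0P t) => ht.
  + have := mulr_ge0 ht (sqr_ge0 (d1 + b1)).
    have := mulr_ge0 ht (sqr_ge0 (d2 - b2)).
    have := sqr_ge0 (c1 + a1); have := sqr_ge0 (c2 - a2); lra.
  + have ht' : 0 <= - t by lra.
    have := mulr_ge0 ht' (sqr_ge0 (d1 - b1)).
    have := mulr_ge0 ht' (sqr_ge0 (d2 + b2)).
    have := sqr_ge0 (c1 + a1); have := sqr_ge0 (c2 - a2); lra.
  + have := mulr_ge0 ht (sqr_ge0 (d1 - b1)).
    have := mulr_ge0 ht (sqr_ge0 (d2 + b2)).
    have := sqr_ge0 (c1 - a1); have := sqr_ge0 (c2 + a2); lra.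
  + have ht' : 0 <= - t by lra.
    have := mulr_ge0 ht' (sqr_ge0 (d1 + b1)).
    have := mulr_ge0 ht' (sqr_ge0 (d2 - b2)).
    have := sqr_ge0 (c1 - a1); have := sqr_ge0 (c2 + a2); lra.
- rewrite -[X in series X]/((fun n => normE t (f n) ^+ 2) +
                            (fun n => normE t (g n) ^+ 2)).
  exact: is_cvg_seriesD.
Qed.

Definition isometric_operator (R : realType) (V : set (hseries R))
    (form : hseries R -> hseries R -> R) (T : hseries R -> hseries R) : Prop :=
  [/\ forall f, V f -> V (T f),
      forall (r : R) (f g : hseries R), V f -> V g ->
        T (fun n => r%:C *: f n + g n) = (fun n => r%:C *: T f n + T g n)
    & forall f g, V f -> V g -> form (T f) (T g) = form f g].

Definition Gamma (R : realType) (t : R) (alpha : 'M[R[i]]_2) : 'M[R[i]]_2 :=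
  limn (series (fun n => alpha ^+ n * star t alpha ^+ n)).

Definition Lop (R : realType) (t : R) (alpha : 'M[R[i]]_2) : 'M[R[i]]_2 :=
  let G := Gamma t alpha in
  G - G * star t alpha * G^-1 * alpha * G.

(* K stands for the chosen square root of [Lop t alpha]. *)
Definition blaschke (R : realType) (t : R) (alpha K : 'M[R[i]]_2) : hseries R :=
  let G := Gamma t alpha in
  fun n => smul (affine_ps (- alpha) 1)
             (sinv (affine_ps 1 (- (G * star t alpha * G^-1)))) n * K.

(* Main.v *)
(* Write G = Gamma_alpha and S = alpha^[*]. The Stein equation G = 1 + alpha G S
   turns the coefficients of B_alpha into -alpha K, C, S C, S^2 C, ... with
   C = G^-1 K, so h = B_alpha * f is the output of the linear system
     x_0 = 0,  x_(n+1) = S x_n + C f_n,  h_n = x_n - alpha K f_n.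
   The definition of K is exactly what makes this system conservative for the
   storage form Tr(y^[*] G x):
     Tr(k_n^[*] h_n) + Tr(y_(n+1)^[*] G x_(n+1)) = Tr(g_n^[*] f_n) + Tr(y_n^[*] G x_n)
   for the output k and the states y belonging to the input g, so the partial
   sums of [B_alpha * f, B_alpha * g] and [f, g] differ by Tr(y_N^[*] G x_N).
   This tends to 0 because S, being unitarily equivalent to alpha, is a strict
   contraction, whence x and y are square summable. *)
Require Import Defs.
From mathcomp Require Import all_boot all_order all_algebra complex ring lra.
From mathcomp Require Import all_classical all_reals all_analysis.
Import Order.TTheory GRing.Theory Num.Theory numFieldNormedType.Exports.
Set Implicit Arguments.
Unset Strict Implicit.
Unset Printing Implicit Defensive.
Local Open Scope ring_scope.
Local Open Scope complex_scope.

(** * Entrywise computation with 2 by 2 matrices *)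

Lemma mul_mx2E (S : pzSemiRingType) (X Y : 'M[S]_2) i j :
  (X * Y) i j = X i 0 * Y 0 j + X i 1 * Y 1 j.
Proof.
rewrite -mulmxE mxE !big_ord_recl big_ord0 addr0.
by congr (_ + X i _ * Y _ j); apply: val_inj.
Qed.

Lemma ord2P (i : 'I_2) : i = 0 \/ i = 1.
Proof. by case: i => [[|[|i]] Hi] //; [left|right]; apply: val_inj. Qed.

Lemma matrix2P (S : Type) (X Y : 'M[S]_2) :
  X 0 0 = Y 0 0 -> X 0 1 = Y 0 1 -> X 1 0 = Y 1 0 -> X 1 1 = Y 1 1 -> X = Y.
Proof.
move=> h00 h01 h10 h11; apply/matrixP => i j.
by case: (ord2P i) => ->; case: (ord2P j) => ->.
Qed.

Lemma conjcD (R : realType) (x y : R[i]) : ((x + y)^*)%C = x^*%C + y^*%C.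
Proof. exact: rmorphD. Qed.

Lemma conjcM (R : realType) (x y : R[i]) : ((x * y)^*)%C = x^*%C * y^*%C.
Proof. exact: rmorphM. Qed.

(* [hmatM] mixes the convertible conjugations [Num.conj] and [conjc], which
   rewriting does not identify. *)
Lemma hmat_mul (R : realType) (t : R) (a b c d : R[i]) :
  hmat t a b * hmat t c d =
  hmat t (a * c + t%:C * b * d^*%C) (a * d + b * c^*%C).
Proof. exact: hmatM. Qed.

(** * [Ht t] as a real algebra with the involution [star t] *)

Section Ht.
Context {R : realType} (t : R).

Lemma hmatD (a b c d : R[i]) : hmat t a b + hmat t c d = hmat t (a + c) (b + d).
Proof. by apply: matrix2P; rewrite !mxE /= ?rmorphD ?mulrDr. Qed.

Lemma hmatZ (r : R) (a b : R[i]) : r%:C *: hmat t a b = hmat t (r%:C * a) (r%:C * b).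
Proof.
by apply: matrix2P; rewrite !mxE /= ?conjcM ?conjc_real // mulrCA.
Qed.

Lemma hmat1 : hmat t 1 0 = 1.
Proof. by apply: matrix2P; rewrite !mxE /= ?mulr0 ?oppr0. Qed.

Lemma Ht1 : Ht t 1. Proof. by exists 1, 0; rewrite hmat1. Qed.

Lemma HtD X Y : Ht t X -> Ht t Y -> Ht t (X + Y).
Proof. by move=> [a [b ->]] [c [d ->]]; rewrite hmatD; do 2 eexists. Qed.

Lemma HtZ (r : R) X : Ht t X -> Ht t (r%:C *: X).
Proof. by move=> [a [b ->]]; rewrite hmatZ; do 2 eexists. Qed.

Lemma HtB X Y : Ht t X -> Ht t Y -> Ht t (X - Y).
Proof.
move=> hX hY; have := HtD hX (HtZ (-1) hY).
by rewrite rmorphN rmorph1 scaleN1r.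
Qed.

Lemma HtM X Y : Ht t X -> Ht t Y -> Ht t (X * Y).
Proof. by move=> [a [b ->]] [c [d ->]]; rewrite hmat_mul; do 2 eexists. Qed.

Lemma Ht0 : Ht t 0.
Proof. by rewrite -(subrr 1); apply: HtB; apply: Ht1. Qed.

Lemma Ht_star X : Ht t X -> Ht t (star t X).
Proof. by move=> [a [b ->]]; rewrite star_hmat; do 2 eexists. Qed.

Lemma starK X : Ht t X -> star t (star t X) = X.
Proof. by move=> [a [b ->]]; rewrite !star_hmat conjcK. Qed.

Lemma star1 : star t 1 = 1.
Proof. by rewrite -hmat1 star_hmat conjc0. Qed.

Lemma starD X Y : Ht t X -> Ht t Y -> star t (X + Y) = star t X + star t Y.
Proof. by move=> [a [b ->]] [c [d ->]]; rewrite hmatD !star_hmat hmatD rmorphD. Qed.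

Lemma starB X Y : Ht t X -> Ht t Y -> star t (X - Y) = star t X - star t Y.
Proof.
move=> hX hY; apply/eqP; rewrite eq_sym subr_eq -starD ?subrK //.
exact: HtB.
Qed.

Lemma starM X Y : Ht t X -> Ht t Y -> star t (X * Y) = star t Y * star t X.
Proof.
move=> [a [b ->]] [c [d ->]]; rewrite hmat_mul !star_hmat hmat_mul.
by congr hmat; rewrite ?conjcD ?conjcM ?conjcK ?conjc_real; ring.
Qed.

End Ht.

(** * [Ht t] as a fixed-point set, and its stability under inverses *)

Section Ht_conjugation.
Context {R : realType} (t : R).
Hypothesis t0 : t != 0.

(* [Ht t] is the set of fixed points of this conjugate-linear ring automorphism
   (conjugation by an antidiagonal matrix composed with entrywise conjugation). *)
Definition Htconj (X : 'M[R[i]]_2) : 'M[R[i]]_2 :=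
  \matrix_(i < 2, j < 2)
    if i == 0 then (if j == 0 then (X 1 1)^*%C else t%:C * (X 1 0)^*%C)
    else (if j == 0 then t%:C^-1 * (X 0 1)^*%C else (X 0 0)^*%C).

Let tC0 : t%:C != 0.
Proof. by rewrite (inj_eq (@complexI R) t 0). Qed.

Lemma Htconj_id X : Ht t X <-> Htconj X = X.
Proof.
split=> [[a [b ->]]|E].
  apply: matrix2P; rewrite !mxE /= ?conjcK //.
  by rewrite conjcM conjc_real mulKf.
(* The first column of X gives a and b; being fixed then forces the second column. *)
exists (X 0 0), (X 1 0)^*%C; rewrite -{1}E.
apply: matrix2P; rewrite !mxE /=.
- by rewrite -{2}E mxE.
- by [].
- by rewrite conjcK -{2}E mxE.
- by [].
Qed.

Lemma HtconjM X Y : Htconj (X * Y) = Htconj X * Htconj Y.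
Proof.
apply: matrix2P; rewrite mul_mx2E ![Htconj _ _ _]mxE /= mul_mx2E conjcD !conjcM;
  field; rewrite ?tC0 //.
Qed.

Lemma HtconjD X Y : Htconj (X + Y) = Htconj X + Htconj Y.
Proof. by apply: matrix2P; rewrite !mxE /= rmorphD ?mulrDr. Qed.

(** [Htconj] is multiplicative and fixes X and 1, so X^-1 and its conjugate are both right inverses
    of X. *)
Lemma Ht_inv X : X \is a GRing.unit -> Ht t X -> Ht t X^-1.
Proof.
move=> uX /Htconj_id hX; apply/Htconj_id; apply: (mulrI uX).
rewrite -{1}hX -HtconjM !divrr //; apply/Htconj_id; exact: Ht1.
Qed.

Lemma star_inv X : X \is a GRing.unit -> Ht t X -> star t X = X ->
  star t X^-1 = X^-1.
Proof.
move=> uX hX sX; apply: (mulIr uX); rewrite mulVr //.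
by rewrite -{2}sX -starM ?divrr ?star1 //; exact: Ht_inv.
Qed.

End Ht_conjugation.

(** * The squared Frobenius norm as a substitute for [normE] *)

Section Frobenius.
Context {R : realType}.

(** The squared modulus, real-valued and free of square roots, so that bounds become polynomial
    inequalities in real variables. *)
Definition nsq (z : R[i]) : R := complex.Re z ^+ 2 + complex.Im z ^+ 2.

Definition frob (X : 'M[R[i]]_2) : R :=
  nsq (X 0 0) + nsq (X 0 1) + nsq (X 1 0) + nsq (X 1 1).

Lemma nsq_ge0 z : 0 <= nsq z.
Proof. by rewrite addr_ge0 ?sqr_ge0. Qed.

Lemma sqr_normcE z : Normc.normc z ^+ 2 = nsq z.
Proof. by case: z => x y; rewrite /= sqr_sqrtr ?addr_ge0 ?sqr_ge0. Qed.

Lemma nsq_conj z : nsq z^*%C = nsq z.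
Proof. by case: z => x y; rewrite /nsq /= sqrrN. Qed.

Lemma nsqM x y : nsq (x * y) = nsq x * nsq y.
Proof. by case: x y => ? ? [? ?]; rewrite /nsq /=; ring. Qed.

Lemma nsq_eq0 z : nsq z = 0 -> z = 0.
Proof.
by move=> h; apply: Normc.eq0_normc; apply/eqP; rewrite -sqrf_eq0 sqr_normcE h.
Qed.

Lemma nsqC (r : R) : nsq r%:C = r ^+ 2.
Proof. by rewrite /nsq /= expr0n addr0. Qed.

(** Young's inequality, with defect e^-1 (e a - b)^2 in each real coordinate. A small e brings the
    factor of [nsq x] close to 1, so that a contraction factor survives. *)
Lemma nsqD e x y : 0 < e -> nsq (x + y) <= (1 + e) * nsq x + (1 + e^-1) * nsq y.
Proof.
move=> e0; case: x y => [x1 x2] [y1 y2]; rewrite /nsq /=.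
have h a b : (a + b) ^+ 2 <= (1 + e) * a ^+ 2 + (1 + e^-1) * b ^+ 2 :> R.
  rewrite -subr_ge0.
  have -> : (1 + e) * a ^+ 2 + (1 + e^-1) * b ^+ 2 - (a + b) ^+ 2 =
            e^-1 * (e * a - b) ^+ 2 by field; rewrite gt_eqF.
  by rewrite mulr_ge0 ?sqr_ge0 // invr_ge0 ltW.
by have := h x1 y1; have := h x2 y2; lra.
Qed.

(* Cauchy-Schwarz, with the defect given by Lagrange's identity. *)
Lemma nsq_dot x y z w : nsq (x * y + z * w) <= (nsq x + nsq z) * (nsq y + nsq w).
Proof.
rewrite -subr_ge0.
have -> : (nsq x + nsq z) * (nsq y + nsq w) - nsq (x * y + z * w) =
          nsq (x * w^*%C - z * y^*%C).
  by case: x y z w => ? ? [? ?] [? ?] [? ?]; rewrite /nsq /=; ring.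
exact: nsq_ge0.
Qed.

Lemma frob_ge0 X : 0 <= frob X.
Proof. by rewrite /frob; do 3!(apply: addr_ge0; last exact: nsq_ge0); exact: nsq_ge0. Qed.

Lemma nsq_le_frob (X : 'M[R[i]]_2) i j : nsq (X i j) <= frob X.
Proof.
have h k l := nsq_ge0 (X k l).
have := h 0 0; have := h 0 1; have := h 1 0; have := h 1 1.
by rewrite /frob; case: (ord2P i) => ->; case: (ord2P j) => ->; lra.
Qed.

Lemma frob_eq0 X : frob X = 0 -> X = 0.
Proof.
move=> X0; apply/matrixP => i j; rewrite mxE; apply: nsq_eq0.
by apply/eqP; rewrite eq_le nsq_ge0 -{1}X0 nsq_le_frob.
Qed.

Lemma frobM X Y : frob (X * Y) <= frob X * frob Y.
Proof.
rewrite {1}/frob !mul_mx2E.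
apply: (le_trans (lerD (lerD (lerD (nsq_dot _ _ _ _) (nsq_dot _ _ _ _))
  (nsq_dot _ _ _ _)) (nsq_dot _ _ _ _))).
by rewrite le_eqVlt; apply/orP; left; apply/eqP; rewrite /frob; ring.
Qed.

Lemma frobD e X Y : 0 < e ->
  frob (X + Y) <= (1 + e) * frob X + (1 + e^-1) * frob Y.
Proof.
move=> e0; rewrite /frob !mxE.
have h i j := nsqD (X i j) (Y i j) e0.
by have := h 0 0; have := h 0 1; have := h 1 0; have := h 1 1; lra.
Qed.

Lemma Re_mxtraceM_le X Y : `|complex.Re (\tr (X * Y))| <= frob X + frob Y.
Proof.
rewrite /mxtrace !big_ord_recl big_ord0 addr0.
have -> : lift ord0 ord0 = 1 :> 'I_2 by apply: val_inj.
rewrite !mul_mx2E.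
have h (x y : R[i]) : `|complex.Re (x * y)| <= nsq x + nsq y.
  case: x y => [x1 x2] [y1 y2]; rewrite /nsq /= ler_norml.
  have := sqr_ge0 (x1 + y1); have := sqr_ge0 (x2 + y2).
  have := sqr_ge0 (x1 - y1); have := sqr_ge0 (x2 - y2).
  have := sqr_ge0 (x1); have := sqr_ge0 (x2).
  have := sqr_ge0 (y1); have := sqr_ge0 (y2).
  by move=> *; apply/andP; split; lra.
rewrite !raddfD /=.
apply: (le_trans (ler_normD _ _)).
apply: (le_trans (lerD (ler_normD _ _) (ler_normD _ _))).
have := h (X 0 0) (Y 0 0); have := h (X 0 1) (Y 1 0).
have := h (X 1 0) (Y 0 1); have := h (X 1 1) (Y 1 1).
rewrite /frob; lra.
Qed.

Lemma frob_star t X : Ht t X -> frob (star t X) = frob X.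
Proof.
move=> [a [b ->]]; rewrite star_hmat /frob !mxE /= !nsqM !nsq_conj; lra.
Qed.

Lemma sqr_normE t X : normE t X ^+ 2 = nsq (X 0 0) + `|t| * nsq (X 1 0).
Proof.
rewrite /normE sqr_sqrtr !sqr_normcE //.
by apply: addr_ge0; rewrite ?mulr_ge0 ?nsq_ge0.
Qed.

Lemma normE_frob t X : normE t X ^+ 2 <= (1 + `|t|) * frob X.
Proof.
rewrite sqr_normE mulrDl mul1r lerD ?nsq_le_frob //.
by rewrite ler_wpM2l ?nsq_le_frob.
Qed.

(** For X = [hmat t a b], [frob X] is 2|a|^2 + (1 + t^2)|b|^2, to be compared with |a|^2 + |t||b|^2;
    the constant is the sum of the two ratios of coefficients. *)
Lemma frob_normE t X : t != 0 -> Ht t X ->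
  frob X <= (2 + (1 + t ^+ 2) / `|t|) * normE t X ^+ 2.
Proof.
move=> t0 [a [b ->]].
rewrite sqr_normE /frob !mxE /= !nsqM !nsq_conj nsqC.
have t1 : 0 < `|t| by rewrite normr_gt0.
have q0 : 0 <= (1 + t ^+ 2) / `|t|.
  by rewrite divr_ge0 // addr_ge0 ?sqr_ge0.
have := mulr_ge0 q0 (nsq_ge0 a).
have := mulr_ge0 (normr_ge0 t) (nsq_ge0 b).
have : (1 + t ^+ 2) / `|t| * (`|t| * nsq b) = (1 + t ^+ 2) * nsq b.
  by field; rewrite gt_eqF.
nra.
Qed.

End Frobenius.

(** * The operator norm as an attained bound on squared lengths *)

Section operator_norm.
Context {R : realType}.

Lemma sqr_norm2 (v : 'cV[R[i]]_2) : norm2 v ^+ 2 = nsq (v 0 0) + nsq (v 1 0).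
Proof.
rewrite /norm2 sqr_sqrtr; last by apply: sumr_ge0 => i _; exact: sqr_ge0.
rewrite !big_ord_recl big_ord0 addr0 !sqr_normcE.
by congr (_ + nsq (v _ _)); apply: val_inj.
Qed.

Lemma norm2_ge0 (v : 'cV[R[i]]_2) : 0 <= norm2 v.
Proof. exact: sqrtr_ge0. Qed.

Lemma norm2Z (r : R) (v : 'cV[R[i]]_2) : 0 <= r -> norm2 (r%:C *: v) = r * norm2 v.
Proof.
move=> r0; apply/eqP; rewrite -(@eqrXn2 _ 2) ?norm2_ge0 ?mulr_ge0 ?norm2_ge0 //.
by rewrite exprMn !sqr_norm2 !mxE !nsqM nsqC -mulrDr eqxx.
Qed.

Lemma mulmx_col2E (q : 'M[R[i]]_2) (v : 'cV[R[i]]_2) i :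
  (q *m v) i 0 = q i 0 * v 0 0 + q i 1 * v 1 0.
Proof.
rewrite mxE !big_ord_recl big_ord0 addr0.
by congr (_ + q i _ * v _ 0); apply: val_inj.
Qed.

Lemma opnorm_has_ubound (q : 'M[R[i]]_2) :
  has_ubound [set norm2 (q *m v) | v in [set v : 'cV[R[i]]_2 | norm2 v <= 1]]%classic.
Proof.
(* From r^2 <= c with c >= 0 follows r <= c + 1, a bound without square roots. *)
exists (frob q + 1) => _ [v /= v1 <-].
have v2 : nsq (v 0 0) + nsq (v 1 0) <= 1.
  by rewrite -sqr_norm2 expr_le1 // norm2_ge0.
have q0 := frob_ge0 q.
have h : norm2 (q *m v) ^+ 2 <= frob q.
  rewrite sqr_norm2 !mulmx_col2E.
  apply: (le_trans (lerD (nsq_dot _ _ _ _) (nsq_dot _ _ _ _))).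
  rewrite -mulrDl addrA; apply: ler_piMr => //; exact: v2.
have := norm2_ge0 (q *m v); nra.
Qed.

Lemma opnorm_ge0 (q : 'M[R[i]]_2) : 0 <= opnorm q.
Proof.
apply: (le_trans (norm2_ge0 (q *m 0))).
apply: ub_le_sup; first exact: opnorm_has_ubound.
exists 0 => //=; suff -> : norm2 (0 : 'cV[R[i]]_2) = 0 by [].
by apply/eqP; rewrite -sqrf_eq0 sqr_norm2 !mxE /nsq /= expr0n /= !addr0.
Qed.

Lemma norm2_le_opnorm (q : 'M[R[i]]_2) v : norm2 (q *m v) <= opnorm q * norm2 v.
Proof.
have [v0|v0] := eqVneq (norm2 v) 0.
  suff -> : v = 0.
    rewrite mulmx0 [norm2 _]( _ : _ = 0) ?mulr_ge0 ?opnorm_ge0 ?norm2_ge0 //.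
    by apply/eqP; rewrite -sqrf_eq0 sqr_norm2 !mxE /nsq /= expr0n /= !addr0.
  have /eqP := sqr_norm2 v; rewrite v0 expr0n /= eq_sym paddr_eq0 ?nsq_ge0 //.
  case/andP => /eqP/nsq_eq0 h0 /eqP/nsq_eq0 h1.
  by apply/matrixP => i j; rewrite mxE (ord1 j); case: (ord2P i) => ->.
have vp : 0 < norm2 v by rewrite lt_def v0 norm2_ge0.
rewrite -ler_pdivrMr // mulrC -norm2Z ?invr_ge0 ?norm2_ge0 // scalemxAr.
apply: ub_le_sup; first exact: opnorm_has_ubound.
exists ((norm2 v)^-1%:C *: v) => //=.
by rewrite norm2Z ?invr_ge0 ?norm2_ge0 // mulVf.
Qed.

Lemma opnorm_contraction (q : 'M[R[i]]_2) x y :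
  nsq (q 0 0 * x + q 0 1 * y) + nsq (q 1 0 * x + q 1 1 * y) <=
  opnorm q ^+ 2 * (nsq x + nsq y).
Proof.
pose v : 'cV[R[i]]_2 := \col_(i < 2) if i == 0 then x else y.
have := norm2_le_opnorm q v.
rewrite -(@ler_pXn2r _ 2) ?nnegrE ?mulr_ge0 ?opnorm_ge0 ?norm2_ge0 //.
by rewrite exprMn !sqr_norm2 !mulmx_col2E !mxE.
Qed.

End operator_norm.

(** * Multiplication by alpha and alpha^[*] contracts [frob] *)

Section contraction.
Context {R : realType} (t : R) (alpha : 'M[R[i]]_2).
Hypothesis halpha : Ht t alpha.

(** [frob X] is the sum of the squared lengths of the columns of X, and alpha acts on each column
    separately. *)
Lemma frob_mulalpha X : frob (alpha * X) <= opnorm alpha ^+ 2 * frob X.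
Proof.
rewrite /frob !mul_mx2E.
have := opnorm_contraction alpha (X 0 0) (X 1 0).
have := opnorm_contraction alpha (X 0 1) (X 1 1).
lra.
Qed.

(* [star t alpha] is conjugate to [alpha] by the unitary matrix [diag(u, 1)]
   where [u * b = b^*]. *)
Lemma frob_mulstar X : frob (star t alpha * X) <= opnorm alpha ^+ 2 * frob X.
Proof.
have [a [b E]] := halpha.
have [u [u1 ub]] : exists u : R[i], nsq u = 1 /\ u * b = b^*%C.
  have [->|b0] := eqVneq b 0.
    exists 1; split; last by rewrite mulr0 conjc0.
    by rewrite /nsq /= expr1n expr0n addr0.
  exists (b^*%C / b); rewrite mulfVK // nsqM nsq_conj -nsqM divff //.
  by rewrite /nsq /= expr1n expr0n addr0.
have h x y : nsq (a * x + t%:C * b^*%C * y) + nsq (b * x + a^*%C * y) <=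
    opnorm alpha ^+ 2 * (nsq x + nsq y).
  have := opnorm_contraction alpha x (u * y).
  rewrite {1 2 3 4}E !mxE /= -ub nsqM u1 mul1r.
  have -> : u * b * x + a^*%C * (u * y) = u * (b * x + a^*%C * y) by ring.
  rewrite nsqM u1 mul1r.
  by have -> : t%:C * b * (u * y) = t%:C * (u * b) * y by ring.
rewrite {1}E star_hmat /frob !mul_mx2E !mxE /= conjcK.
have := h (X 0 0) (X 1 0); have := h (X 0 1) (X 1 1).
lra.
Qed.

(* A row vector [(x, y)] times [star t alpha] is, up to exchanging and
   conjugating the entries, [alpha] applied to the column [(y^*, x^* )]. *)
Lemma frob_mulrstar X : frob (X * star t alpha) <= opnorm alpha ^+ 2 * frob X.
Proof.
have [a [b E]] := halpha.
have h x y : nsq (x * a + y * b) + nsq (x * (t%:C * b^*%C) + y * a^*%C) <=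
    opnorm alpha ^+ 2 * (nsq x + nsq y).
  have := opnorm_contraction alpha y^*%C x^*%C.
  rewrite {1 2 3 4}E !mxE /= !nsq_conj.
  rewrite -(nsq_conj (a * _ + _)) -(nsq_conj (b^*%C * _ + _)).
  rewrite !conjcD !conjcM !conjcK conjc_real.
  have -> : b * y + a * x = x * a + y * b by ring.
  have -> : a^*%C * y + t%:C * b^*%C * x = x * (t%:C * b^*%C) + y * a^*%C by ring.
  lra.
rewrite {1}E star_hmat /frob !mul_mx2E !mxE /= conjcK.
have := h (X 0 0) (X 0 1); have := h (X 1 0) (X 1 1).
lra.
Qed.

End contraction.

(** * The Stein equation X = 1 + A X B and its series solution *)

Section Stein.
Context {R : realType} (A B : 'M[R[i]]_2) (rho : R).
Hypotheses (rho_ge0 : 0 <= rho) (rho_lt1 : rho < 1).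
Hypothesis contrA : forall X, frob (A * X) <= rho * frob X.
Hypothesis contrB : forall X, frob (X * B) <= rho * frob X.

(** Each passage from Z to A Z B gains one factor rho, taken from B; of A it is only used that it
    does not expand. *)
Lemma frob_conj_exp X n : frob (A ^+ n * X * B ^+ n) <= rho ^+ n * frob X.
Proof.
elim: n X => [|n IH] X; first by rewrite !expr0 !mul1r mulr1.
have -> : A ^+ n.+1 * X * B ^+ n.+1 = A ^+ n * (A * X * B) * B ^+ n.
  by rewrite exprSr exprS !mulrA.
apply: (le_trans (IH _)).
rewrite exprSr -[leRHS]mulrA ler_wpM2l ?exprn_ge0 //.
apply: (le_trans (contrB _)); rewrite ler_wpM2l //.
apply: (le_trans (contrA _)).
by rewrite ler_piMl ?frob_ge0 // ltW.
Qed.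

Lemma stein_homogeneous X : X = A * X * B -> X = 0.
Proof.
move=> E; apply: frob_eq0; apply/eqP; rewrite eq_le frob_ge0 andbT.
have h : frob X <= rho * frob X.
  rewrite {1}E; apply: (le_trans (contrB _)); rewrite ler_wpM2l //.
  by apply: (le_trans (contrA _)); rewrite ler_piMl ?frob_ge0 // ltW.
by rewrite -(pmulr_rle0 (frob X) (x := 1 - rho)) ?subr_gt0 // mulrBl mul1r subr_le0.
Qed.

Lemma stein_unique X Y : X = 1 + A * X * B -> Y = 1 + A * Y * B -> X = Y.
Proof.
move=> EX EY; apply/eqP; rewrite -subr_eq0; apply/eqP/stein_homogeneous.
by rewrite {1}EX {1}EY mulrBr mulrBl opprD addrACA subrr add0r.
Qed.

(** In finite dimension the linear map X - A X B, injective by [stein_homogeneous], is onto. A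
    solution is thus at hand before any convergence is known. *)
Lemma stein_exists : exists G, G = 1 + A * G * B.
Proof.
pose f : {linear 'M[R[i]]_2 -> 'M[R[i]]_2} := (idfun \- (mulmxr B \o mulmx A)).
have fE X : linfun f X = X - A * X * B by rewrite lfunE.
have /lker0_limgf imf : lker (linfun f) == 0%VS.
  apply/lker0P => X Y /eqP; rewrite -subr_eq0 -raddfB /= fE subr_eq0 => /eqP E.
  by apply/eqP; rewrite -subr_eq0; apply/eqP/stein_homogeneous.
have : (1 : 'M[R[i]]_2) \in limg (linfun f) by rewrite imf memvf.
case/memv_imgP => G _; rewrite fE => E.
by exists G; rewrite E subrK.
Qed.

(** The sum telescopes, since A^k B^k = A^k (G - A G B) B^k. *)
Lemma stein_partial_sum G n : G = 1 + A * G * B ->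
  series (fun k => A ^+ k * B ^+ k) n = G - A ^+ n * G * B ^+ n.
Proof.
move=> EG; elim: n => [|n IH].
  by rewrite /series /= big_geq // !expr0 mul1r mulr1 subrr.
rewrite seriesSr IH exprSr exprS; apply/eqP; rewrite eq_sym subr_eq; apply/eqP.
have -> : A ^+ n * A * G * (B * B ^+ n) = A ^+ n * (G - 1) * B ^+ n.
  by rewrite {2}EG addrC addKr !mulrA.
by rewrite mulrBr mulrBl mulr1 -addrA [_ + (_ - _)]addrC !subrK.
Qed.

(** The matrix topology comes from the largest modulus of an entry; it is attained, and [frob]
    dominates the square of every modulus. *)
Lemma mx_norm_lt (X : 'M[R[i]]_2) (e : R) : 0 < e -> frob X < e ^+ 2 -> `|X| < e%:C.
Proof.
move=> e0 h; have [X0|X0] := eqVneq (mx_norm X) 0.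
  by rewrite [`|X|]X0 ltcR.
have [[i j] /= E] := mx_norm_neq0 X0.
rewrite [`|X|]E normc_def ltcR -(@ltr_pXn2r _ 2) ?nnegrE ?sqrtr_ge0 ?(ltW e0) //.
rewrite sqr_sqrtr ?nsq_ge0 //; exact: le_lt_trans (nsq_le_frob X i j) h.
Qed.

Lemma stein_series_cvg G : G = 1 + A * G * B ->
  limn (series (fun k => A ^+ k * B ^+ k)) = G.
Proof.
move=> EG; apply: cvg_lim; first exact: norm_hausdorff.
apply/cvgrPdist_lt => eps eps0.
(* A positive element of [R[i]] has zero imaginary part. *)
have [e e0 ->] : exists2 e : R, 0 < e & eps = e%:C.
  case: eps eps0 => e e'; rewrite ltcE /= => /andP[/eqP -> e0]; by exists e.
have : (geometric (frob G) rho n @[n --> \oo] --> (0 : R))%classic.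
  by apply: cvg_geometric; rewrite ger0_norm.
have e20 : 0 < e ^+ 2 by rewrite exprn_gt0.
move=> /cvgrPdist_lt /(_ _ e20); apply: filterS => n /= h.
rewrite (stein_partial_sum _ EG) opprB addrC subrK; apply: mx_norm_lt => //.
apply: le_lt_trans (frob_conj_exp _ _) _.
apply: le_lt_trans h; rewrite sub0r normrN mulrC; exact: ler_norm.
Qed.

End Stein.

(** * Gamma_alpha solves the Stein equation and is self-adjoint in [Ht t] *)

Section Gamma.
Context {R : realType} (t : R) (alpha : 'M[R[i]]_2).
Hypotheses (t0 : t != 0) (halpha : Ht t alpha) (alpha1 : opnorm alpha < 1).

Lemma sqr_opnorm_lt1 : opnorm alpha ^+ 2 < 1.
Proof. by rewrite expr_lt1 ?opnorm_ge0. Qed.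

Let unique := stein_unique (sqr_ge0 _) sqr_opnorm_lt1
  (frob_mulalpha alpha) (frob_mulrstar halpha).

Lemma GammaE : Gamma t alpha = 1 + alpha * Gamma t alpha * star t alpha.
Proof.
have [G EG] := stein_exists (sqr_ge0 _) sqr_opnorm_lt1
  (frob_mulalpha alpha) (frob_mulrstar halpha).
rewrite /Gamma.
by rewrite (stein_series_cvg (sqr_ge0 _) sqr_opnorm_lt1
  (frob_mulalpha alpha) (frob_mulrstar halpha) EG).
Qed.

(** [Htconj] fixes alpha and alpha^[*], so it maps Gamma_alpha to a solution of the same Stein
    equation; uniqueness concludes. *)
Lemma Ht_Gamma : Ht t (Gamma t alpha).
Proof.
apply/(Htconj_id t0)/unique; last exact: GammaE.
rewrite {1}GammaE HtconjD // !HtconjM // (Htconj_id t0 _).1; last exact: Ht1.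
rewrite ((Htconj_id t0 alpha).1 halpha).
by rewrite ((Htconj_id t0 (star t alpha)).1 (Ht_star halpha)).
Qed.

(** The involution reverses products and exchanges alpha with alpha^[*], so it too preserves the
    Stein equation. *)
Lemma star_Gamma : star t (Gamma t alpha) = Gamma t alpha.
Proof.
apply: unique; last exact: GammaE.
have hG := Ht_Gamma; have hs := Ht_star halpha.
rewrite {1}GammaE starD ?star1 ?starM ?starK ?mulrA //; try exact: HtM.
- exact: Ht1.
- by apply: HtM => //; exact: HtM.
Qed.

End Gamma.

(** * Convergence of nonnegative series and membership in [H2] *)

Section real_series.
Context {R : realType}.

(** Summing the recursion bounds (1 - rho) times each partial sum of u by u_0 plus the sum of c. *)
Lemma series_contraction_cvg (rho : R) (u c : nat -> R) : 0 <= rho -> rho < 1 ->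
  (forall n, 0 <= u n) -> (forall n, 0 <= c n) ->
  (forall n, u n.+1 <= rho * u n + c n) -> cvgn (series c) -> cvgn (series u).
Proof.
move=> r0 r1 u0 c0 h cc.
have ndu : nondecreasing_seq (series u).
  by apply/nondecreasing_seqP => n; rewrite seriesSr lerDl.
have ndc : nondecreasing_seq (series c).
  by apply/nondecreasing_seqP => n; rewrite seriesSr lerDl.
have step n : series u n.+1 <= u 0%N + rho * series u n + series c n.
  elim: n => [|n IH].
    by rewrite seriesSr /series /= !big_geq // add0r mulr0 !addr0.
  rewrite seriesSr [series u n.+1 in leRHS]seriesSr [series c n.+1]seriesSr.
  by have := h n; lra.
apply: nondecreasing_is_cvgn => //.
exists ((u 0%N + limn (series c)) / (1 - rho)) => _ [n _ <-].
rewrite ler_pdivlMr ?subr_gt0 //.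
have := step n; have := ndu n n.+1 (leqnSn n).
have := nondecreasing_cvgn_le ndc cc n; lra.
Qed.

Lemma series_lin_le_cvg (a b : R) (u v w : nat -> R) :
  (forall n, 0 <= u n) -> (forall n, u n <= a * v n + b * w n) ->
  cvgn (series v) -> cvgn (series w) -> cvgn (series u).
Proof.
move=> u0 h cv cw; apply: (series_le_cvg u0 _ h).
  by move=> n; exact: le_trans (h n).
rewrite -[X in series X]/((a *: v) + (b *: w)).
by apply: is_cvg_seriesD; apply: is_cvg_seriesZ.
Qed.

End real_series.

Section H2.
Context {R : realType} (t : R).
Hypothesis t0 : t != 0.

Lemma H2_frob (f : hseries R) :
  H2 t f <-> (forall n, Ht t (f n)) /\ cvgn (series (fun n => frob (f n))).
Proof.
split=> -[hf cf]; split=> //.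
  apply: (@series_lin_le_cvg _ (2 + (1 + t ^+ 2) / `|t|) 0 _ _ _ _ _ cf cf).
    by move=> n; exact: frob_ge0.
  by move=> n; rewrite mul0r addr0; exact: frob_normE.
apply: (@series_lin_le_cvg _ (1 + `|t|) 0 _ _ _ _ _ cf cf).
  by move=> n; exact: sqr_ge0.
by move=> n; rewrite mul0r addr0; exact: normE_frob.
Qed.

End H2.

(** * Star-products with affine series and as outputs of linear systems *)

Section power_series.
Context {R : realType}.
Implicit Types (f g : hseries R) (c : 'M[R[i]]_2).

Lemma smul_affinel0 c0 c1 g : smul (affine_ps c0 c1) g 0%N = c0 * g 0%N.
Proof. by rewrite /smul big_ord_recl big_ord0 addr0. Qed.

Lemma smul_affinelS c0 c1 g n :
  smul (affine_ps c0 c1) g n.+1 = c0 * g n.+1 + c1 * g n.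
Proof.
rewrite /smul !big_ord_recr /= subnn subSnn big1 ?add0r 1?addrC // => k _.
have -> : (n.+1 - k)%N = (n - k.+1).+2.
  by rewrite subnSK ?ltn_ord // subSn // ltnW // ltn_ord.
by rewrite mul0r.
Qed.

Lemma smul_affiner0 f c0 c1 : smul f (affine_ps c0 c1) 0%N = f 0%N * c0.
Proof. by rewrite /smul big_ord_recl big_ord0 addr0. Qed.

Lemma smul_affinerS f c0 c1 n :
  smul f (affine_ps c0 c1) n.+1 = f n.+1 * c0 + f n * c1.
Proof.
rewrite /smul !big_ord_recl /= big1; last by move=> k _; rewrite mulr0.
by rewrite addr0 !subn0 subn1.
Qed.

(** The geometric series is an inverse, so [xget] does not return its default. Any inverse T
    satisfies T_0 = 1 and T_(n+1) = b T_n, which identifies the chosen one. *)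
Lemma sinv_affine (b : 'M[R[i]]_2) : sinv (affine_ps 1 (- b)) = fun n => b ^+ n.
Proof.
have : is_sinv (affine_ps 1 (- b)) (sinv (affine_ps 1 (- b))).
  apply: (@xgetPex _ _ [set T | is_sinv (affine_ps 1 (- b)) T]%classic).
  exists (fun n => b ^+ n); split; apply/funext => -[|n].
  - by rewrite smul_affinel0 mulr1.
  - by rewrite smul_affinelS mul1r exprS mulNr subrr; case: n.
  - by rewrite smul_affiner0 mulr1.
  - by rewrite smul_affinerS mulr1 exprSr mulrN subrr; case: n.
case=> /funeqP h _; apply/funext; elim=> [|n IH].
  by have := h 0%N; rewrite smul_affinel0 mul1r.
have := h n.+1; rewrite smul_affinelS mul1r mulNr IH -exprS.
have -> : affine_ps 1 0 n.+1 = 0 :> 'M[R[i]]_2 by case: n {IH}.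
by move/eqP; rewrite subr_eq0 => /eqP.
Qed.

(** In closed form, the sum over k < n of S^(n-1-k) C f_k. *)
Fixpoint state S C f n : 'M[R[i]]_2 :=
  if n is n'.+1 then S * state S C f n' + C * f n' else 0.

Lemma smul_state S C D (B : hseries R) f n :
  B 0%N = D -> (forall n, B n.+1 = S ^+ n * C) ->
  smul B f n = state S C f n + D * f n.
Proof.
move=> B0 BS; rewrite /smul big_ord_recr /= subnn B0; congr (_ + _).
elim: n => [|n IH]; first by rewrite big_ord0.
rewrite big_ord_recr /= subSnn BS expr0 mul1r -IH mulr_sumr; congr (_ + _).
apply: eq_bigr => k _; rewrite /= subSn ?(ltnW (ltn_ord k)) // mulrA; congr (_ * _).
case: (n - k)%N (subn_gt0 k n) => [|m _]; first by rewrite ltn_ord.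
by rewrite !BS exprS mulrA.
Qed.

End power_series.

(** * Noncommutative identities derived from the Stein equation *)

Section stein_algebra.
Context {A : unitRingType} (a S G K : A).
Hypotheses (uG : G \is a GRing.unit) (GE : a * G * S = G - 1).

(** Powers of G S G^-1 are G S^n G^-1, so the left side is (G - a G S) S^n G^-1 K, whose first
    factor is 1. *)
Lemma stein_resolvent n :
  ((G * S * G^-1) ^+ n - a * (G * S * G^-1) ^+ n.+1) * K = S ^+ n * (G^-1 * K).
Proof.
have E m : (G * S * G^-1) ^+ m = G * S ^+ m * G^-1.
  elim: m => [|m IH]; first by rewrite !expr0 mulr1 divrr.
  by rewrite exprSr IH exprSr !mulrA mulrVK.
by rewrite !E exprS !mulrA GE !mulrBl mul1r subKr.
Qed.

(** Woodbury's formula for the inverse of G^-1 + S a, where the inner factor 1 + a G S equals G. *)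
Lemma stein_woodbury :
  (S * a + G^-1) * (G - G * S * G^-1 * a * G) = 1.
Proof.
have E : S * a * G * S = S * G - S.
  by rewrite -!mulrA (mulrA a) GE mulrBr mulr1.
rewrite mulrDl !mulrBr mulVr // !mulrA mulVr // mul1r E.
by rewrite !mulrBl mulrK // subKr addrC subrK.
Qed.

(** Y, P stand for y^[*], g^[*] and X, F for x, f. The mixed terms Y..F and P..X cancel between the
    two products, the P..F terms combine by [EK], and the Y..X terms by the Stein equation. *)
Lemma stein_energy (Y X P F : A) :
  K * (S * a + G^-1) * K = 1 ->
  (Y - P * (K * S)) * (X - a * K * F) +
    (Y * a + P * (K * G^-1)) * G * (S * X + G^-1 * K * F) =
  P * F + Y * G * X.
Proof.
move=> EK.
have -> : (Y - P * (K * S)) * (X - a * K * F) =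
  Y * X + P * (K * (S * a) * K) * F - (Y * a * K * F + P * K * S * X).
  rewrite mulrBr !mulrBl !mulrA opprB addrACA opprD; congr (_ + _); exact: addrC.
have -> : (Y * a + P * (K * G^-1)) * G * (S * X + G^-1 * K * F) =
  Y * (a * G * S) * X + P * (K * G^-1 * K) * F + (Y * a * K * F + P * K * S * X).
  rewrite mulrDr !mulrDl !mulrA !mulrVK // !mulrK // [X in _ + X]addrC addrACA.
  by congr (_ + _); exact: addrC.
rewrite addrACA addNr addr0 GE mulrBr mulr1 mulrBl addrACA.
rewrite -mulrDl -mulrDr -mulrDl -mulrDr EK mulr1 addrC; congr (_ + _).
by rewrite addrC subrK.
Qed.

End stein_algebra.

(** * State-space realization of B_alpha and its energy balance *)

Section state_space.
Context {R : realType} (t : R) (alpha K : 'M[R[i]]_2).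
Hypotheses (t0 : t != 0) (halpha : Ht t alpha) (alpha1 : opnorm alpha < 1).
Hypotheses (uG : Gamma t alpha \is a GRing.unit).
Hypotheses (hK : Ht t K) (sK : star t K = K) (hKL : K ^+ 2 = Lop t alpha).

Let G := Gamma t alpha.
Let S := star t alpha.
Let C := G^-1 * K.
Let B := blaschke t alpha K.

Let GE : alpha * G * S = G - 1.
Proof. by rewrite [in RHS]/G (GammaE halpha alpha1) addrC addKr. Qed.

Lemma blaschke0 : B 0%N = - (alpha * K).
Proof. by rewrite /B /blaschke smul_affinel0 sinv_affine expr0 mulr1 mulNr. Qed.

Lemma blaschkeS n : B n.+1 = S ^+ n * C.
Proof.
rewrite /B /blaschke smul_affinelS sinv_affine -/G -/S mul1r addrC mulNr.
exact: stein_resolvent.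
Qed.

(** By [stein_woodbury], (S alpha + G^-1) K is a left inverse of K; for square matrices it is also a
    right inverse. *)
Lemma sqrt_Lop_inv : K * (S * alpha + G^-1) * K = 1.
Proof.
rewrite -mulrA; apply: mulmx1C; rewrite !mulmxE -mulrA -expr2 hKL.
exact: stein_woodbury.
Qed.

Section trajectory.
Variable f : hseries R.
Hypothesis hf : H2 t f.
Let x := state S C f.

Lemma Ht_state n : Ht t (x n).
Proof.
elim: n => [|n IH] /=; first exact: Ht0.
apply: HtD; first by apply: HtM => //; exact: Ht_star.
apply: HtM; last by case: hf.
by apply: HtM => //; apply: Ht_inv => //; exact: Ht_Gamma.
Qed.

Lemma cvg_frob_state : cvgn (series (fun n => frob (x n))).
Proof.
have [hfn cf] := (H2_frob t0 f).1 hf.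
have [r0 r1] := (sqr_ge0 (opnorm alpha), sqr_opnorm_lt1 alpha1).
set rho := opnorm alpha ^+ 2 in r0 r1.
(* With this e, 1 - (1 + e) rho = (1 - rho)(2 - rho) / 2 > 0. *)
pose e := (1 - rho) / 2.
have e0 : 0 < e by rewrite divr_gt0 // subr_gt0.
apply: (@series_contraction_cvg _ ((1 + e) * rho) _
  (fun n => (1 + e^-1) * frob C * frob (f n))).
- by rewrite mulr_ge0 // addr_ge0 // ltW.
- rewrite /e; nra.
- by move=> n; exact: frob_ge0.
- by move=> n; rewrite !mulr_ge0 ?frob_ge0 // addr_ge0 // invr_ge0 ltW.
- move=> n /=; apply: (le_trans (frobD _ _ e0)); apply: lerD.
    by rewrite -mulrA ler_wpM2l ?frob_mulstar // addr_ge0 // ltW.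
  by rewrite -mulrA ler_wpM2l ?frobM // addr_ge0 // invr_ge0 ltW.
- rewrite -[X in series X]/(((1 + e^-1) * frob C) *: (fun n => frob (f n))).
  exact: is_cvg_seriesZ.
Qed.

Lemma smul_blaschke n : smul B f n = x n - alpha * K * f n.
Proof. by rewrite (smul_state f n blaschke0 blaschkeS) mulNr. Qed.

Lemma H2_smul_blaschke : H2 t (smul B f).
Proof.
have [hfn cf] := (H2_frob t0 f).1 hf.
apply/H2_frob => //; split=> [n|].
  rewrite smul_blaschke; apply: HtB; first exact: Ht_state.
  by apply: HtM => //; exact: HtM.
(* Both factors 2 come from [frobD] with e = 1. *)
apply: (series_lin_le_cvg _ _ cvg_frob_state cf (a := 2) (b := 2 * frob (- (alpha * K)))).
  by move=> n; exact: frob_ge0.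
move=> n /=; rewrite smul_blaschke -mulNr.
apply: (le_trans (frobD _ _ ltr01)); rewrite invr1 -[_ * frob (f n)]mulrA lerD //.
by rewrite ler_wpM2l ?addr_ge0 ?frobM.
Qed.

End trajectory.

Lemma energy_balance f g n : H2 t f -> H2 t g ->
  let x := state S C f in let y := state S C g in
  star t (smul B g n) * smul B f n + star t (y n.+1) * G * x n.+1 =
  star t (g n) * f n + star t (y n) * G * x n.
Proof.
move=> hf hg x y; have [[hfn _] [hgn _]] := (hf, hg).
have hx := Ht_state hf; have hy := Ht_state hg.
have hGi : Ht t G^-1 by apply: Ht_inv => //; exact: Ht_Gamma.
have sGi : star t G^-1 = G^-1.
  by apply: star_inv => //; [exact: Ht_Gamma | exact: star_Gamma].
have hS : Ht t S by exact: Ht_star.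
have hC : Ht t C by exact: HtM.
have haK : Ht t (alpha * K) by exact: HtM.
rewrite !smul_blaschke // /x /y /= -/x -/y.
have hSy : Ht t (S * y n) by exact: HtM.
have hCg : Ht t (C * g n) by exact: HtM.
have haKg : Ht t (alpha * K * g n) by exact: HtM.
rewrite starB // starD // !starM // starK // sK sGi -/S.
apply: stein_energy => //; exact: sqrt_Lop_inv.
Qed.

Lemma kform_smul_blaschke f g : H2 t f -> H2 t g ->
  kform t (smul B f) (smul B g) = kform t f g.
Proof.
move=> hf hg; set x := state S C f; set y := state S C g.
pose v n := complex.Re (\tr (star t (y n) * G * x n)).
(* The stored energy vanishes in the limit: the states are square summable, so their [frob] tends to
   0. *)
have cv : (v n @[n --> \oo] --> (0 : R))%classic.
  have cx := cvg_series_cvg_0 (cvg_frob_state hf).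
  have cy := cvg_series_cvg_0 (cvg_frob_state hg).
  apply: (@squeeze_cvgr _ _ _ _
    (fun n => - (frob (y n) * frob G + frob (x n)))
    (fun n => frob (y n) * frob G + frob (x n))).
  - apply: nearW => n; rewrite -ler_norml.
    apply: le_trans (Re_mxtraceM_le _ _) _; rewrite lerD2r.
    apply: le_trans (frobM _ _) _; rewrite frob_star //; exact: Ht_state.
  - rewrite -oppr0; apply: cvgN; rewrite -[0]addr0; apply: cvgD => //.
    by rewrite -(mul0r (frob G)); apply: cvgMr_tmp.
  - rewrite -[0]addr0; apply: cvgD => //.
    by rewrite -(mul0r (frob G)); apply: cvgMr_tmp.
(* The energy balance telescopes, starting from v_0 = 0 because the initial states are 0. *)
have E : series (fun n => complex.Re (\tr (star t (smul B g n) * smul B f n))) =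
  (fun N => series (fun n => complex.Re (\tr (star t (g n) * f n))) N - v N).
  apply/funext; elim=> [|n IH].
    by rewrite /series /= !big_geq // /v /x /= mulr0 mxtrace0 subrr.
  rewrite !seriesSr IH; have := energy_balance n hf hg.
  move=> /(congr1 (fun M => complex.Re (\tr M))).
  rewrite /= !mxtraceD !raddfD /= -/x -/y -/(v n) -/(v n.+1); lra.
rewrite /kform E; apply: cvg_lim; first exact: Rhausdorff.
rewrite -[X in (_ --> X)%classic]subr0; apply: cvgB => //.
exact: (kform_cvg hf hg).
Qed.

End state_space.

Theorem theorem5p5 (R : realType) (t : R) (ht : t != 0)
    (alpha K : 'M[R[i]]_2) (halpha : Ht t alpha)
    (halpha1 : opnorm alpha < 1)
    (hGamma : Gamma t alpha \is a GRing.unit)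
    (hK : Ht t K) (hKstar : K = star t K) (hKL : K ^+ 2 = Lop t alpha) :
  isometric_operator (H2 t) (kform t)
    (fun f : hseries R => smul (blaschke t alpha K) f).
Proof.
split.
- by move=> f hf; apply: H2_smul_blaschke.
- move=> r f g _ _; apply/funext => n; rewrite /smul scaler_sumr -big_split.
  by apply: eq_bigr => k _; rewrite mulrDr scalerAr.
- by move=> f g hf hg; apply: kform_smul_blaschke.
Qed.
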